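(* For every integer $d\geq 3$ there exists $c>0$ such that for every sufficiently large $n$ there exists a set $P$ of $n$ points in $\mathbb{R}^d$ whose Delaunay graph with respect to axis-parallel boxes has independence number at most $$\frac{c\,n(\log\log n)^{(d+3)/2}}{(\log n)^{(d-1)/2}}.$$
   Context: An axis-parallel box in $\mathbb{R}^d$ is a product of $d$ bounded intervals. For a finite set $P\subset\mathbb{R}^d$, its Delaunay graph with respect to axis-parallel boxes is the graph on vertex set $P$ in which distinct $x,y\in P$ are adjacent if and only if there exists an axis-parallel box $C$ with $C\cap P=\{x,y\}$. *)

(* Defs.v *)
From HB Require Import structures.
From mathcomp Require Import all_boot all_order all_algebra finmap.
From mathcomp Require Import all_classical all_reals all_analysis.
Import Order.TTheory GRing.Theory Num.Theory.
Import numFieldNormedType.Exports.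

Set Implicit Arguments.
Unset Strict Implicit.
Unset Printing Implicit Defensive.

Local Open Scope classical_set_scope.
Local Open Scope ring_scope.

(* Loops are not tested separately: the graph relation [e] is meant to be
   irreflexive, so [x = y] imposes no condition. *)
Definition independent (T : finType) (e : rel T) (S : {set T}) : bool :=
  [forall x in S, forall y in S, ~~ e x y].

Definition independence_number (T : finType) (e : rel T) : nat :=
  \max_(S : {set T} | independent e S) #|S|.

(* The bounded intervals may be open, closed, half-open or degenerate. *)
Definition axis_parallel_box (R : realType) (d : nat)
    (C : set 'rV[R]_d) : Prop :=
  exists2 I : 'I_d -> set R,
    forall i, is_interval (I i) /\ bounded_set (I i) &
    C = [set v | forall i, I i (v ord0 i)].

(* The vertex type is the finite type of elements of [P]. *)
Definition delaunay_graph (R : realType) (d : nat) (P : {fset 'rV[R]_d}) :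
    rel P :=
  fun x y => `[< x <> y /\
    exists2 C : set 'rV[R]_d,
      axis_parallel_box C & C `&` [set` P] = [set val x; val y] >].

(* Main.v *)
Require Import Defs.
From HB Require Import structures.
From mathcomp Require Import all_boot all_order all_algebra finmap.
From mathcomp Require Import all_classical all_reals all_analysis.
From mathcomp Require Import zify ring lra.
(* Repeated so that the finite-set names take precedence over the homonymous
   ones of classical_sets. *)
From mathcomp Require Import fintype finset.
Import Order.TTheory GRing.Theory Num.Theory.
Import numFieldNormedType.Exports.

Set Implicit Arguments.
Unset Strict Implicit.
Unset Printing Implicit Defensive.

Local Open Scope ring_scope.

(* The points are indexed by 0, ..., n-1, and the index is the first coordinate.
   The other coordinates have uniformly random digits: M digits in base Q for
   the second one (the colours), and a digits in base B for each of the e = d - 2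
   remaining ones (the directions).

   A level j < M and a scale t in [a]^e cut the points into cells, according to
   the first j colour digits and the first t_i digits in each direction i. If u
   and v lie in the same cell, have the same next colour digit, and no point
   between them in the cell has that colour digit, then a box isolates them.

   Fix a set I of k points, and write n ~ s k. At each level and scale all but
   few of the pairs of consecutive elements of I in a cell have at most 4s points
   of the cell between them. If B is large then, by Markov's inequality, few
   such pairs agree in their next digit in some direction; the remaining ones
   determine their scale, so the a^e scales together give a graph on I with at
   least k a^e / 2 edges and degrees at most 2 a^e. When the colours of a level
   are drawn, each edge is hit with probability of order 1/Q, Q ~ s, and
   revealing the colours of I one by one shows that the probability of hitting
   none is at most exp(- c k a^e / s), even though the events are dependent.
   Levels being independent, I stays independent with probability at most
   exp(- c k M a^e / s), which beats the number of choices of I as soon as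
   M a^e >> s log s. With r ~ (log n)^(1/4), the choice a = r^2, M = r^3,
   s = r^(2(d-1)) ~ (log n)^((d-1)/2) satisfies this while leaving fewer than
   k/8 cells. *)

(** * Resampling one value of a random function *)

Section Resampling.
Variables (A T : finType).
Implicit Types (f : {ffun A -> T}) (a : A) (x : T).

Definition upd f a x : {ffun A -> T} := [ffun b => if b == a then x else f b].

Lemma upd_same f a x : upd f a x a = x.
Proof. by rewrite ffunE eqxx. Qed.

Lemma upd_other f a x b : b != a -> upd f a x b = f b.
Proof. by rewrite ffunE => /negbTE ->. Qed.

(** Exchanging the new value [x] with the old value [f a] is an involution on the pairs [(f, x)];
    reindexing by it turns [upd f a x] into [f]. *)
Lemma sum_upd (V : nmodType) a (G : {ffun A -> T} -> V) :
  \sum_f \sum_x G (upd f a x) = (\sum_f G f) *+ #|T|.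
Proof.
rewrite pair_big /=.
pose h (p : {ffun A -> T} * T) := (upd p.1 a p.2, p.1 a).
have hK : involutive h.
  move=> [f x]; rewrite /h /= upd_same; congr pair.
  by apply/ffunP => b; rewrite !ffunE; case: eqP => [->|].
rewrite (reindex_inj (inv_inj hK)) /=.
transitivity (\sum_(p : {ffun A -> T} * T) G p.1).
  by apply: eq_bigr => p _; have := congr1 fst (hK p) => /= ->.
rewrite -(pair_big xpredT xpredT (fun f (_ : T) => G f)) /= -sumrMnl.
by apply: eq_bigr => f _; rewrite sumr_const.
Qed.

(** Conditioning in counting form: a bound on the average over the value at [a], valid whatever the
    other values are, passes to the average over all functions. Iterating it replaces any appeal to
    independence. *)
Lemma resample_le (K : realFieldType) a (rho : K) (G G' : {ffun A -> T} -> K) :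
  (0 < #|T|)%N ->
  (forall f, \sum_x G' (upd f a x) <= rho * #|T|%:R * G f) ->
  \sum_f G' f <= rho * \sum_f G f.
Proof.
move=> T0 step; have T0' : 0 < #|T|%:R :> K by rewrite ltr0n.
rewrite -(ler_pM2r T0') mulr_natr -(sum_upd a).
apply: le_trans (ler_sum _ (fun f _ => step f)) _.
by rewrite -mulr_sumr mulrAC.
Qed.

End Resampling.

(** * Random colourings of a graph with forbidden intermediate colours *)

(** By induction: a new factor [1 - a] produces the cross term [a * S / 2], which is at most [a / 2]
    because [S <= 1]. *)
Lemma prod_1B_le (K : realFieldType) (J : Type) (r : seq J) (P : pred J)
    (y : J -> K) :
  (forall j, 0 <= y j) -> \sum_(j <- r | P j) y j <= 1 ->
  \prod_(j <- r | P j) (1 - y j) <= 1 - (\sum_(j <- r | P j) y j) / 2.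
Proof.
move=> y0; elim: r => [|j r IH]; first by rewrite !big_nil mul0r subr0.
rewrite !big_cons; case: (P j) => // le1.
have := IH _; have s0 : 0 <= \sum_(i <- r | P i) y i by apply: sumr_ge0.
move: le1 s0 (y0 j); set S := \sum_(i <- r | P i) y i; set a := y j.
set p := \prod_(i <- r | P i) _ => le1 s0 a0 IHp.
have {}IHp : p <= 1 - S / 2 by apply: IHp; lra.
have : (1 - a) * p <= (1 - a) * (1 - S / 2) by apply: ler_wpM2l => //; lra.
by nra.
Qed.

Lemma sum_indicator (K : realFieldType) (T : finType) (A B : pred T) :
  \sum_(c | A c) (B c)%:R = #|[pred c | A c && B c]|%:R :> K.
Proof.
rewrite -natr_sum; congr (_%:R); rewrite -sum1_card.
under [RHS]eq_bigl do rewrite inE.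
by rewrite [RHS]big_mkcondr; apply: eq_bigr => c _; case: (B c).
Qed.

Section Colouring.
Variables (K : realType) (n : nat) (T : finType) (m D : nat).
Variables (I : {set 'I_n}) (E : rel 'I_n) (Bt : 'I_n -> 'I_n -> {set 'I_n}).
Implicit Types (w : {ffun 'I_n -> T}) (u v p x : 'I_n) (c : T).

Let Q := #|T|.
Hypotheses (mQ : (4 * m <= Q)%N) (DQ : (8 * D <= Q)%N) (Q0 : (0 < Q)%N).
Hypothesis EI : forall u v, E u v -> [/\ u \in I, v \in I & (u < v)%N].
Hypothesis BtI : forall u v, E u v -> [disjoint Bt u v & I].
Hypothesis Btm : forall u v, E u v -> (#|Bt u v| <= m)%N.
Hypothesis degin : forall v, (#|[set u | E u v]| <= D)%N.
Hypothesis degout : forall u, (#|[set v | E u v]| <= D)%N.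

Definition allowed w u v c := [forall z in Bt u v, w z != c].
(** A violated edge is one that the colouring hits. Properness thus means that nothing is hit, and
    proper colourings are to be shown rare. *)
Definition violated w u v := [&& E u v, w u == w v & allowed w u v (w u)].
Definition proper_upto w (k : nat) :=
  [forall u : 'I_n, [forall v : 'I_n, (v < k)%N ==> ~~ violated w u v]].

Lemma allowedP w u v c :
  reflect (forall z, z \in Bt u v -> w z != c) (allowed w u v c).
Proof. exact: forall_inP. Qed.

Lemma proper_uptoP w k :
  reflect (forall u v, (v < k)%N -> ~~ violated w u v) (proper_upto w k).
Proof.
apply: (iffP forallP) => [H u v|H u]; first by move/forall_inP: (H u); apply.
by apply/forall_inP => v; apply: H.
Qed.

(** These are the colours that would make [v] complete a hit edge with a vertex below [k]. By [BtI]
    the test [allowed] for an edge reads only colours outside [I], so recolouring a vertex of [I]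
    cannot change it. *)
Definition forbidden w (k : nat) v : {set T} :=
  [set w p | p in [set p : 'I_n | [&& (p < k)%N, E p v & allowed w p v (w p)]]].

(* The probability that the vertices [v >= k], coloured independently at
   random, all avoid the colours forbidden to them by the vertices below [k],
   if the vertices below [k] are properly coloured. *)
Definition potential w (k : nat) : K :=
  (proper_upto w k)%:R * \prod_(v < n | (k <= v)%N) (1 - #|forbidden w k v|%:R / Q%:R).

Lemma card_forbidden w k v : (#|forbidden w k v| <= D)%N.
Proof.
apply: leq_trans (leq_imset_card _ _) _; apply: leq_trans (degin v).
by apply/subset_leq_card/subsetP => u; rewrite !inE => /and3P[].
Qed.

Lemma potential_split w x :
  potential w x = (proper_upto w x)%:R * (1 - #|forbidden w x x|%:R / Q%:R)
    * \prod_(v < n | (x < v)%N) (1 - #|forbidden w x v|%:R / Q%:R).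
Proof.
rewrite /potential (bigD1 x) //= mulrA; congr (_ * _); apply: eq_bigl => v.
by rewrite ltn_neqAle eq_sym andbC.
Qed.

(** A vertex outside [I] has no edges: nothing is forbidden to it and it forbids nothing. *)
Lemma potential_out w x : x \notin I -> potential w x.+1 = potential w x.
Proof.
move=> xI; rewrite potential_split.
have Ex v : E x v = false by apply/negP => /EI[]; rewrite (negbTE xI).
have xE v : E v x = false by apply/negP => /EI[]; rewrite (negbTE xI).
have -> : forbidden w x x = set0.
  apply/setP => c; rewrite inE; apply/imsetP => -[p].
  by rewrite inE xE andbF.
rewrite cards0 mul0r subr0 mulr1; congr ((nat_of_bool _)%:R * _).
  apply/proper_uptoP/proper_uptoP => H u v; first by move=> vx; apply: H; rewrite ltnS ltnW.
  rewrite ltnS leq_eqVlt => /predU1P[/val_inj->|]; last exact: H.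
  by rewrite /violated xE.
apply: eq_bigr => v xv; congr (1 - (#|pred_of_set _|)%:R / _).
apply/setP => c; apply/imsetP/imsetP => -[p]; rewrite inE => /and3P[pk Ep al] ->.
  exists p => //; rewrite inE Ep al !andbT ltn_neqAle -ltnS pk andbT.
  by apply/eqP => /val_inj px; rewrite px Ex in Ep.
by exists p => //; rewrite inE Ep al !andbT ltnS ltnW.
Qed.

Section Recolour.
Variables (w : {ffun 'I_n -> T}) (x : 'I_n).
Hypothesis xI : x \in I.

Lemma allowed_upd c u v : E u v -> allowed (upd w x c) u v =1 allowed w u v.
Proof.
move=> Euv c'.
have updE z : z \in Bt u v -> upd w x c z = w z.
  move=> zB; rewrite upd_other //; apply: contraTneq xI => <-.
  by have /disjointFr -> := BtI Euv.
by apply/allowedP/allowedP => H z zB; have := H z zB; rewrite updE.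
Qed.

Lemma forbidden_upd c v :
  forbidden (upd w x c) x.+1 v =
  forbidden w x v :|: [set c' | (c' == c) && (E x v && allowed w x v c)].
Proof.
apply/setP => c'; rewrite !inE; apply/imsetP/orP => [[p]|[/imsetP[p]|]].
- rewrite inE => /and3P[]; case: (eqVneq p x) => [-> _ Exv|px pk Ep].
    by rewrite allowed_upd // upd_same => al ->; right; rewrite eqxx Exv.
  rewrite allowed_upd // upd_other // => al ->; left; apply/imsetP; exists p => //.
  by rewrite inE Ep al !andbT ltn_neqAle -ltnS pk andbT.
- rewrite inE => /and3P[pk Ep al] ->.
  have px : p != x by apply: contraTneq pk => ->; rewrite ltnn.
  by exists p; rewrite ?upd_other // inE Ep allowed_upd // upd_other // al !andbT ltnS ltnW.
case/and3P => /eqP-> Exv al; exists x; rewrite ?upd_same // inE ltnS leqnn Exv /=.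
by rewrite allowed_upd // upd_same.
Qed.

Lemma proper_upd c :
  proper_upto (upd w x c) x.+1 = proper_upto w x && (c \notin forbidden w x x).
Proof.
have low u v : (v < x)%N -> violated (upd w x c) u v = violated w u v.
  move=> vx; rewrite /violated; apply: andb_id2l => Euv; have [_ _ uv] := EI Euv.
  have vNx : v != x by apply: contraTneq vx => ->; rewrite ltnn.
  have uNx : u != x by apply: contraTneq (ltn_trans uv vx) => ->; rewrite ltnn.
  by rewrite allowed_upd // !upd_other.
apply/proper_uptoP/andP => [H|[/proper_uptoP H cF] u v].
  split.
    by apply/proper_uptoP => u v vx; rewrite -low //; apply: H; rewrite ltnS ltnW.
  apply/imsetP => -[p]; rewrite inE => /and3P[px Ep al] cp.
  have /negP := H p x (ltnSn x); apply.
  have pNx : p != x by apply: contraTneq px => ->; rewrite ltnn.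
  by rewrite /violated Ep allowed_upd // upd_same upd_other // cp eqxx.
rewrite ltnS leq_eqVlt => /predU1P[/val_inj->|vx]; last by rewrite low //; apply: H.
apply: contra cF => /and3P[Eux]; have [_ _ ux] := EI Eux.
have uNx : u != x by apply: contraTneq ux => ->; rewrite ltnn.
rewrite allowed_upd // upd_same upd_other // => /eqP <- al.
by apply/imsetP; exists u => //; rewrite inE ux Eux.
Qed.

(** The colours of [x] that enlarge the forbidden set of [v]. *)
Let fresh v := [set c | E x v && allowed w x v c] :\: forbidden w x v.

Lemma card_forbidden_upd c v :
  #|forbidden (upd w x c) x.+1 v| = (#|forbidden w x v| + (c \in fresh v))%N.
Proof.
rewrite forbidden_upd !inE; case: (E x v && _) => /=; last first.
  rewrite andbF addn0; congr #|pred_of_set _|; apply/setP => c'; rewrite !inE.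
  by rewrite andbF orbF.
have -> : [set c' | (c' == c) && true] = [set c].
  by apply/setP => c'; rewrite !inE andbT.
by rewrite setUC cardsU1 addnC andbT.
Qed.

(** At most [m] colours are blocked by the points of [Bt x v], and at most [D] lie in each of the
    two forbidden sets; [m + 2 * D] is at most [Q / 2]. *)
Lemma card_fresh v : E x v -> (Q <= 2 * #|fresh v :\: forbidden w x x|)%N.
Proof.
move=> Exv; have Fv := card_forbidden w x v; have Fx := card_forbidden w x x.
have Bv : (#|[set w z | z in Bt x v]| <= m)%N.
  exact: leq_trans (leq_imset_card _ _) (Btm Exv).
suff : (Q <= #|fresh v :\: forbidden w x x| + #|forbidden w x v|
             + #|forbidden w x x| + #|[set w z | z in Bt x v]|)%N by lia.
rewrite -[Q]cardsT.
apply: (@leq_trans #|(fresh v :\: forbidden w x x) :|: forbidden w x v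
   :|: forbidden w x x :|: [set w z | z in Bt x v]|).
  apply/subset_leq_card/subsetP => c _; rewrite !inE Exv /=.
  case: (c \in forbidden w x x); rewrite ?orbT //=.
  case: (c \in forbidden w x v); rewrite ?orbT //= ?orbF.
  case: allowedP => //= al; apply/imsetP; apply: contra_notP al => H z zB.
  by apply/eqP => zc; apply: H; exists z.
by do 3!(apply: leq_trans (leq_card_setU _ _) _; rewrite leq_add2r).
Qed.

(** If [x] gets a colour that is not forbidden to it, each [v] for which that colour is fresh loses
    [1 / Q] in its factor, and by [prod_1B_le] the product loses at least half of the total.
    Averaged over the colours of [x], half of which are fresh for any given out-neighbour by
    [card_fresh], this is a relative loss of [1 / (4 * Q)] per outgoing edge. *)
Lemma potential_step :
  \sum_c potential (upd w x c) x.+1 <=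
  (1 - #|[set v | E x v]|%:R / (4 * Q%:R)) * Q%:R * potential w x.
Proof.
have Qp : 0 < Q%:R :> K by rewrite ltr0n.
set d := #|_|; rewrite potential_split.
set F := fun v => #|forbidden w x v|; rewrite -/(F x).
pose y c v : K := (c \in fresh v)%:R / Q%:R.
have F_le v : (F v)%:R <= Q%:R :> K.
  rewrite ler_nat; apply: leq_trans (card_forbidden _ _ _) _; lia.
have Fx1 v : 0 <= 1 - (F v)%:R / Q%:R :> K by rewrite subr_ge0 ler_pdivrMr ?mul1r.
pose P : K := \prod_(v < n | (x < v)%N) (1 - (F v)%:R / Q%:R).
rewrite -/P; have P0 : 0 <= P by apply: prodr_ge0.
have Zle c : \sum_(v < n | (x < v)%N) y c v <= 1.
  rewrite -mulr_suml sum_indicator ler_pdivrMr // mul1r ler_nat.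
  apply: leq_trans (_ : D <= _)%N; last by lia.
  apply: leq_trans (degout x); apply/subset_leq_card/subsetP => v.
  by rewrite !inE => /andP[_] /and3P[].
have termle c : potential (upd w x c) x.+1 <=
    (proper_upto w x)%:R * P * ((c \notin forbidden w x x)%:R
      * (1 - (\sum_(v < n | (x < v)%N) y c v) / 2)).
  rewrite /potential proper_upd; case: (proper_upto w x) => /=; last by rewrite !mul0r.
  case: (c \notin forbidden w x x); last by rewrite !(mul0r, mulr0).
  (* With [f] the old forbidden fraction and [y] the increment, [1 - f - y <= (1 - f) * (1 - y)]. *)
  rewrite !mul1r; apply: le_trans (_ : P * \prod_(v < n | (x < v)%N) (1 - y c v) <= _).
    rewrite -big_split /=; apply: ler_prod => v _; rewrite card_forbidden_upd.
    rewrite subr_ge0 ler_pdivrMr // mul1r ler_nat -/(F v) /y.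
    apply/andP; split.
      have := card_forbidden w x v; rewrite -/(F v); case: (c \in _) => /=; lia.
    have F0 : 0 <= (F v)%:R / Q%:R :> K by rewrite divr_ge0 ?ler0n.
    have q0 : 0 <= (c \in fresh v)%:R / Q%:R :> K by rewrite divr_ge0 ?ler0n.
    rewrite natrD mulrDl; nra.
  apply: ler_wpM2l => //; apply: prod_1B_le => // v.
  by rewrite /y divr_ge0 ?ler0n.
apply: le_trans (ler_sum _ (fun c _ => termle c)) _; rewrite -mulr_sumr.
rewrite [leRHS](_ : _ = (proper_upto w x)%:R * P
   * ((1 - d%:R / (4 * Q%:R)) * (Q%:R - (F x)%:R))); last by field; lra.
apply: ler_wpM2l; first by rewrite mulr_ge0.
have -> : \sum_c (c \notin forbidden w x x)%:R
     * (1 - (\sum_(v < n | (x < v)%N) y c v) / 2) =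
   Q%:R - (F x)%:R - (\sum_(v < n | (x < v)%N) #|fresh v :\: forbidden w x x|%:R) / (2 * Q%:R) :> K.
  under eq_bigr do rewrite mulrBr mulr1.
  rewrite sumrB; congr (_ - _).
    rewrite sum_indicator -natrB; last by have := F_le x; rewrite ler_nat.
    rewrite /F /Q -(cardC (mem (forbidden w x x))) addKn; congr (_%:R).
  rewrite invfM [2^-1 * _]mulrC mulrA mulr_suml mulr_suml.
  transitivity (\sum_c \sum_(v < n | (x < v)%N)
     (c \notin forbidden w x x)%:R * (c \in fresh v)%:R / Q%:R / 2 :> K).
    apply: eq_bigr => c _; rewrite mulr_suml mulr_sumr.
    by apply: eq_bigr => v _; rewrite !mulrA.
  rewrite exchange_big /=; apply: eq_bigr => v _.
  rewrite -!mulr_suml; congr (_ / _ / _).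
  under eq_bigr do rewrite -natrM mulnb.
  by rewrite sum_indicator; congr (_%:R); apply: eq_card => c; rewrite !inE.
have dS : d%:R * Q%:R / 2 <= \sum_(v < n | (x < v)%N) #|fresh v :\: forbidden w x x|%:R :> K.
  rewrite -natr_sum ler_pdivrMr // -!natrM ler_nat.
  apply: leq_trans (_ : (\sum_(v | E x v) Q <= _)%N).
    by rewrite sum_nat_const /d cardsE.
  rewrite mulnC big_distrr /= [leqRHS](bigID (E x)) /=.
  apply: leq_trans (leq_addr _ _).
  rewrite [leqRHS](eq_bigl (E x)); last first.
    by move=> v /=; case Exv: (E x v); rewrite ?andbF // andbT; have [] := EI Exv.
  by apply: leq_sum => v; exact: card_fresh.
move: dS; set S := \sum_(v | _) _ => dS.
have -> : (1 - d%:R / (4 * Q%:R)) * (Q%:R - (F x)%:R) =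
  Q%:R - (F x)%:R - d%:R / 4 + d%:R * (F x)%:R / (4 * Q%:R) :> K by field; lra.
have Fd0 : 0 <= d%:R * (F x)%:R / (4 * Q%:R) :> K by rewrite divr_ge0 ?mulr_ge0 ?ler0n //; lra.
suff : d%:R / 4 <= S / (2 * Q%:R) by lra.
rewrite ler_pdivlMr; last by lra.
by lra.
Qed.

End Recolour.

(** The potential is at most 1 at [k = 0] and is the indicator of properness at [k = n]. Exposing a
    vertex of out-degree [d] costs a factor [1 - d / (4 * Q) <= expR (- d / (4 * Q))], and the
    out-degrees add up to the number of edges. *)
Theorem proper_colouring_bound :
  \sum_(w : {ffun 'I_n -> T}) [forall u : 'I_n, [forall v : 'I_n, ~~ violated w u v]]%:R <=
  expR (- (#|[set uv | E uv.1 uv.2]|%:R / (4 * Q%:R))) * #|{ffun 'I_n -> T}|%:R :> K.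
Proof.
have Qp : 0 < Q%:R :> K by rewrite ltr0n.
pose dg u : nat := #|[set v | E u v]|.
have cE : #|[set uv | E uv.1 uv.2]| = (\sum_(u < n) dg u)%N.
  rewrite -sum1_card /dg; under [RHS]eq_bigr do rewrite -sum1_card.
  rewrite pair_big_dep /=; apply: eq_bigl => -[u v].
  by rewrite !inE.
have key k : (k <= n)%N -> \sum_w potential w k <=
    expR (- ((\sum_(u < n | (u < k)%N) dg u)%:R / (4 * Q%:R)))
      * #|{ffun 'I_n -> T}|%:R :> K.
  elim: k => [_|k IH kn].
    rewrite (_ : (\sum_(u < n | (u < 0)%N) dg u = 0)%N); last by rewrite big_pred0.
    rewrite mul0r oppr0 expR0 mul1r -sumr_const ler_sum // => w _.
    rewrite /potential big1 ?mulr1 ?lern1 ?leq_b1 // => v _.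
    rewrite (_ : forbidden w 0 v = set0) ?cards0 ?mul0r ?subr0 //.
    by apply/setP => c; rewrite inE; apply/imsetP => -[p]; rewrite inE.
  pose x := Ordinal kn.
  have sumS : (\sum_(u < n | (u < k.+1)%N) dg u = dg x + \sum_(u < n | (u < k)%N) dg u)%N.
    rewrite (bigD1 x) //=; congr addn; apply: eq_bigl => u.
    by rewrite ltnS [RHS]ltn_neqAle andbC.
  have {}IH := IH (ltnW kn); rewrite sumS.
  set S := (\sum_(u < n | (u < k)%N) dg u)%N in IH *.
  have -> : (dg x + S)%:R / (4 * Q%:R) = (dg x)%:R / (4 * Q%:R) + S%:R / (4 * Q%:R) :> K.
    by rewrite natrD mulrDl.
  rewrite opprD expRD -mulrA.
  apply: le_trans (ler_wpM2l (expR_ge0 _) IH).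
  have [xI|xI] := boolP (x \in I).
    apply: (@resample_le _ _ _ x) => // w.
    apply: le_trans (potential_step w xI) _.
    apply: ler_wpM2r; last apply: ler_wpM2r; rewrite ?ler0n //.
      rewrite mulr_ge0 ?ler0n // prodr_ge0 // => v _.
      rewrite subr_ge0 ler_pdivrMr // mul1r ler_nat.
      by apply: leq_trans (card_forbidden _ _ _) _; lia.
    exact: expR_ge1Dx.
  rewrite (_ : dg x = 0)%N ?mul0r ?oppr0 ?expR0 ?mul1r.
    rewrite le_eqVlt; apply/orP; left; apply/eqP/eq_bigr => w _.
    exact: (potential_out w xI).
  by apply/eqP; rewrite cards_eq0; apply/eqP/setP => v; rewrite !inE;
     apply/negP => /EI[]; rewrite (negbTE xI).
have -> : #|[set uv | E uv.1 uv.2]| = (\sum_(u < n | (u < n)%N) dg u)%N.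
  by rewrite cE; apply: eq_bigl => u; rewrite ltn_ord.
apply: le_trans (key n (leqnn n)); apply: ler_sum => w _.
rewrite /potential big_pred0 => [|v]; last by rewrite leqNgt ltn_ord.
rewrite mulr1 ler_nat; case: forallP => // H; rewrite lt0b.
by apply/proper_uptoP => u v _; move/forallP: (H u); apply.
Qed.

End Colouring.

(** * Consecutive pairs in the cells of a partition *)

Section ConsecutivePairs.
Variables (n : nat) (S : finType) (f : 'I_n -> S) (I : {set 'I_n}).
Implicit Types (u v z : 'I_n).

Definition between u v : {set 'I_n} :=
  [set z : 'I_n | [&& (u < z)%N, (z < v)%N & f z == f u]].
Definition consecutive u v :=
  [&& u \in I, v \in I, (u < v)%N, f u == f v & [disjoint between u v & I]].

Lemma consecutiveN u v z :
  consecutive u v -> z \in I -> (u < z)%N -> (z < v)%N -> f z != f u.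
Proof.
move=> /and5P[_ _ _ _ dis] zI uz zv; apply: contraTneq zI => fz.
by rewrite (disjointFr dis) // inE uz zv fz eqxx.
Qed.

Lemma consecutive_injl u u' v : consecutive u v -> consecutive u' v -> u = u'.
Proof.
wlog: u u' / (u <= u')%N => [W c c'|].
  by case: (leqP u u') => [le|/ltnW le]; [exact: W|symmetry; exact: W].
rewrite leq_eqVlt => /orP[/eqP/val_inj//|uu'] c c'.
have /and5P[u'I _ u'v /eqP fu' _] := c'; have /and5P[_ _ _ /eqP fu _] := c.
by have := consecutiveN c u'I uu' u'v; rewrite fu' fu eqxx.
Qed.

Lemma consecutive_injr u v v' : consecutive u v -> consecutive u v' -> v = v'.
Proof.
wlog: v v' / (v <= v')%N => [W c c'|].
  by case: (leqP v v') => [le|/ltnW le]; [exact: W|symmetry; exact: W].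
rewrite leq_eqVlt => /orP[/eqP/val_inj//|vv'] c c'.
have /and5P[_ vI uv /eqP fuv _] := c.
by have := consecutiveN c' vI uv vv'; rewrite fuv eqxx.
Qed.

(** Every element of [I] that is not the first of its cell is the right end of a consecutive pair,
    and there are at most as many first elements as cells meeting [I]. *)
Lemma card_consecutive :
  (#|I| <= #|[set uv | consecutive uv.1 uv.2]| + #|f @: I|)%N.
Proof.
pose first := [set v in I | [forall (u | u \in I), (f u == f v) ==> (v <= u)%N]].
have first_inj : {in first &, injective f}.
  move=> v v'; rewrite !inE => /andP[vI /forall_inP vle] /andP[v'I /forall_inP v'le] fv.
  apply/val_inj/eqP; rewrite eqn_leq.
  by rewrite (implyP (vle _ v'I)) ?fv // (implyP (v'le _ vI)) ?fv.
have firstI : first \subset I by apply/subsetP => v; rewrite inE => /andP[].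
rewrite -(cardsID first I) addnC leq_add //; last first.
  rewrite (setIidPr firstI) -(card_in_imset first_inj).
  exact/subset_leq_card/imsetS.
apply: leq_trans (leq_imset_card snd _); apply/subset_leq_card/subsetP => v.
rewrite !inE => /andP[nf vI]; move: nf; rewrite vI /= => /forall_inPn[u0 u0I].
rewrite negb_imply -ltnNge => /andP[fu0 u0v].
pose P u := [&& u \in I, f u == f v & (u < v)%N].
have P0 : P u0 by rewrite /P u0I fu0.
case: (arg_maxnP (fun u : 'I_n => val u) P0) => u /and3P[uI fu uv] umax.
apply/imsetP; exists (u, v) => //; rewrite inE /= /consecutive uI vI uv fu /=.
rewrite disjoint_subset; apply/subsetP => z; rewrite !inE => /and3P[uz zv fz].
apply: contraL uz => zI; rewrite -leqNgt; apply: umax.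
by rewrite /P zI zv (eqP fz) fu.
Qed.

(** Double counting: a point [z] lies between the ends of at most one consecutive pair of its own
    cell. *)
Lemma card_long m :
  (#|[set uv | consecutive uv.1 uv.2 & (m <= #|between uv.1 uv.2|)%N]| * m <= n)%N.
Proof.
set L := [set _ | _ & _]; rewrite -sum_nat_const.
apply: (@leq_trans (\sum_(uv in L) \sum_(z | z \in between uv.1 uv.2) 1)).
  by apply: leq_sum => uv; rewrite inE sum1_card => /andP[].
under eq_bigr do rewrite big_mkcond; rewrite exchange_big /=.
rewrite -[leqRHS]card_ord -[leqRHS]sum1_card; apply: leq_sum => z _.
rewrite -big_mkcondr /= sum1dep_card; apply/card_le1_eqP => -[u v] [u' v'].
rewrite !inE /= => /andP[/andP[c _] /and3P[uz zv /eqP fz]].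
move=> /andP[/andP[c' _] /and3P[u'z zv' /eqP fz']].
have [/and3P[uI _ _] /and3P[u'I _ _]] := (c, c').
have uu' : u = u'.
  case: (ltngtP u u') => [lt|lt|/val_inj//].
    by have := consecutiveN c u'I lt (ltn_trans u'z zv); rewrite -fz' fz eqxx.
  by have := consecutiveN c' uI lt (ltn_trans uz zv'); rewrite -fz fz' eqxx.
by rewrite -uu' in c' *; rewrite (consecutive_injr c c').
Qed.

(** Along the cell of [u], the size of [between u v] increases strictly with [v], so it is an
    injective label below [m]. *)
Lemma card_near u m :
  (#|[set v : 'I_n | [&& (u < v)%N, f v == f u & (#|between u v| < m)%N]]| <= m)%N.
Proof.
set A := [set _ | _]; rewrite cardE -(size_map (fun v => #|between u v|)).
rewrite -[leqRHS](size_iota 0).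
apply: uniq_leq_size => [|x /mapP[v]]; last first.
  by rewrite mem_enum inE mem_iota => /and3P[_ _ lt] ->.
rewrite map_inj_in_uniq ?enum_uniq // => v v'; rewrite !mem_enum !inE.
wlog: v v' / (v <= v')%N => [W a a' e|].
  by case: (leqP v v') => [le|/ltnW le]; [exact: W|symmetry; apply: W].
rewrite leq_eqVlt => /orP[/eqP/val_inj//|vv'] /and3P[uv fv _] /and3P[uv' fv' _].
move=> e; suff : (#|between u v| < #|between u v'|)%N by rewrite e ltnn.
apply/proper_card/properP; split.
  by apply/subsetP => z; rewrite !inE => /and3P[-> /= zv ->]; rewrite (ltn_trans zv).
by exists v; rewrite !inE ?uv ?vv' ?ltnn ?andbF.
Qed.

End ConsecutivePairs.

(** * Levels and scales *)

Section Levels.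
Variables (K : realType) (n e a M q b m : nat).
Let key : finType := ('I_n * ('I_e * 'I_a))%type.
Let scale := {ffun 'I_e -> 'I_a}.
Implicit Types (Y : {ffun key -> 'I_b.+1}) (W : {ffun 'I_M -> {ffun 'I_n -> 'I_q.+1}}).
Implicit Types (x : {ffun 'I_n -> 'I_q.+1}) (j : 'I_M) (t : scale) (i : 'I_e).
Implicit Types (u v z : 'I_n) (I : {set 'I_n}).

(** Digits beyond the prefixes are replaced by [ord0], so that the cells of all levels and scales
    live in one finite type, whose cardinality bounds their number. *)
Definition cell Y W j t u : {ffun 'I_M -> 'I_q.+1} * {ffun 'I_e * 'I_a -> 'I_b.+1} :=
  ([ffun l : 'I_M => if (l < j)%N then W l u else ord0],
   [ffun il : 'I_e * 'I_a => if (il.2 < t il.1)%N then Y (u, il) else ord0]).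

Definition near Y W j t u v :=
  [&& (u < v)%N, cell Y W j t v == cell Y W j t u
    & (#|between (cell Y W j t) u v| < m)%N].

(* A near pair that also shares its next digit in direction [i] may be near at
   several scales, so it must not be counted. *)
Definition bad Y W j t i u v :=
  near Y W j t u v && (Y (u, (i, t i)) == Y (v, (i, t i))).

Definition bad_count Y W j :=
  (\sum_t \sum_i \sum_u \sum_v bad Y W j t i u v)%N.

(** The colour digits [x] of level [j] are a separate argument: the cells of level [j] ignore them,
    so they can be drawn while the cells stay fixed. *)
Definition edge Y W j t x u v :=
  [&& (u < v)%N, cell Y W j t v == cell Y W j t u, x u == x v
    & [forall z in between (cell Y W j t) u v, x z != x u]].

Definition edge_free Y W j x I :=
  ~~ [exists t, [exists u in I, [exists v in I, edge Y W j t x u v]]].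

Lemma cellP Y W j t u v :
  reflect ((forall l : 'I_M, (l < j)%N -> W l u = W l v) /\
           (forall i (l : 'I_a), (l < t i)%N -> Y (u, (i, l)) = Y (v, (i, l))))
          (cell Y W j t u == cell Y W j t v).
Proof.
apply: (iffP eqP) => [[/ffunP eW /ffunP eY]|[eW eY]].
  split=> [l lj|i l lt]; first by have := eW l; rewrite !ffunE lj.
  by have := eY (i, l); rewrite !ffunE /= lt.
congr pair; apply/ffunP => l; rewrite !ffunE; case: ifP => //; first exact: eW.
by case: l => i l /=; exact: eY.
Qed.

(** Nearness at scale [t] reads only the digits before position [t i], so redrawing that digit of
    [u] leaves it unchanged and meets the digit of [v] for one value out of [b.+1]. *)
Lemma sum_bad W j t i u v :
  \sum_Y (bad Y W j t i u v)%:R <= b.+1%:R^-1 * \sum_Y (near Y W j t u v)%:R :> K.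
Proof.
apply: (@resample_le _ _ _ (u, (i, t i))); rewrite ?card_ord // => Y.
rewrite mulVf ?pnatr_eq0 // mul1r.
have cell_upd c : cell (upd Y (u, (i, t i)) c) W j t = cell Y W j t.
  apply/funext => p; congr pair; apply/ffunP => -[i' l]; rewrite !ffunE /=.
  by case: ifP => // lt; case: eqP lt => // -[_ -> ->]; rewrite ltnn.
have nearE c : near (upd Y (u, (i, t i)) c) W j t u v = near Y W j t u v.
  by rewrite /near cell_upd.
have [/[dup] nuv /and3P[uv _ _]|nuv] := boolP (near Y W j t u v); last first.
  by rewrite big1 // => c _; rewrite /bad nearE (negbTE nuv).
rewrite (bigD1 (Y (v, (i, t i)))) //= big1 ?addr0 => [|c cv].
  by rewrite ler_nat leq_b1.
rewrite /bad upd_same upd_other ?(negbTE cv) ?andbF //.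
by apply: contraTneq uv => -[->]; rewrite ltnn.
Qed.

Lemma sum_bad_count W :
  \sum_Y (\sum_j bad_count Y W j)%:R <=
  (M * a ^ e * e * n * m)%:R / b.+1%:R * #|{ffun key -> 'I_b.+1}|%:R :> K.
Proof.
have nearS Y j t : (\sum_u \sum_v near Y W j t u v <= n * m)%N.
  apply: (@leq_trans (\sum_(u < n) m)); last by rewrite sum_nat_const card_ord.
  apply: leq_sum => u _.
  apply: leq_trans (card_near (cell Y W j t) u m).
  rewrite -sum1_card [leqRHS]big_mkcond /=; apply: leq_sum => v _.
  by rewrite inE -/(near _ _ _ _ _ _); case: near.
apply: (@le_trans _ _ (\sum_j \sum_t \sum_i
    (b.+1%:R^-1 * \sum_Y (\sum_u \sum_v near Y W j t u v)%:R))).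
  under eq_bigr do rewrite natr_sum.
  rewrite exchange_big; apply: ler_sum => j _ /=; rewrite /bad_count.
  under eq_bigr do rewrite natr_sum.
  rewrite exchange_big; apply: ler_sum => t _ /=.
  under eq_bigr do rewrite natr_sum.
  rewrite exchange_big; apply: ler_sum => i _ /=.
  under eq_bigr do rewrite natr_sum.
  under [in leRHS]eq_bigr do rewrite natr_sum.
  rewrite exchange_big [in leRHS]exchange_big mulr_sumr; apply: ler_sum => u _ /=.
  under eq_bigr do rewrite natr_sum.
  under [in leRHS]eq_bigr do rewrite natr_sum.
  rewrite exchange_big [in leRHS]exchange_big mulr_sumr; apply: ler_sum => v _ /=.
  exact: sum_bad.
apply: (@le_trans _ _ (\sum_(j < M) \sum_(t : scale) \sum_(i < e)
    (b.+1%:R^-1 * (#|{ffun key -> 'I_b.+1}| * (n * m))%:R))).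
  apply: ler_sum => j _; apply: ler_sum => t _; apply: ler_sum => i _.
  rewrite ler_wpM2l ?invr_ge0 // -natr_sum ler_nat.
  rewrite -cardsT -sum_nat_const [leqRHS](eq_bigl xpredT) => [|Y]; last by rewrite inE.
  by apply: leq_sum => Y _; exact: nearS.
have cs : #|{: scale}| = (a ^ e)%N by rewrite card_ffun !card_ord.
rewrite !sumr_const !card_ord cs; set X := #|_|.
rewrite -[leLHS]mulr_natr -![(_ *+ _) *+ _]mulr_natr -[_ *+ e]mulr_natr.
by rewrite le_eqVlt !natrM; apply/orP; left; apply/eqP; ring.
Qed.

Section Level.
Variables (k : nat) (Y : {ffun key -> 'I_b.+1})
  (W : {ffun 'I_M -> {ffun 'I_n -> 'I_q.+1}}) (j : 'I_M) (I : {set 'I_n}).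
Hypotheses (m0 : (0 < m)%N) (Ik : #|I| = k).
Hypothesis cells : (8 * (q.+1 ^ M * b.+1 ^ (e * a)) <= k)%N.
Hypothesis mk : (4 * n <= m * k)%N.
Hypotheses (mq : (4 * m <= q.+1)%N) (aq : (8 * a ^ e <= q.+1)%N).
Hypothesis few_bad : (8 * bad_count Y W j <= k)%N.

Let cl t := cell Y W j t.
Let good t u v := [&& consecutive (cl t) I u v, (#|between (cl t) u v| < m)%N
  & [forall i, Y (u, (i, t i)) != Y (v, (i, t i))]].

(** For a good pair, [t i] is the length of the common prefix in direction [i], so the pair
    determines its scale. *)
Lemma good_inj t t' u v : good t u v -> good t' u v -> t = t'.
Proof.
suff le s s' i : good s u v -> good s' u v -> (s' i <= s i)%N.
  by move=> g g'; apply/ffunP => i; apply/val_inj/eqP; rewrite eqn_leq !le.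
move=> /and3P[_ _ /forallP/(_ i) ne] /and3P[/and5P[_ _ _ /cellP[_ eY] _] _ _].
by rewrite leqNgt; apply: contra ne => lt; rewrite (eY _ _ lt).
Qed.

(** From the [k] elements, at most [k / 8] are lost to the cells, [k / 4] to long pairs and [k / 8]
    to bad pairs, which leaves [k / 2]. *)
Lemma card_good t : (k <= 2 * #|[set uv | good t uv.1 uv.2]|)%N.
Proof.
have := card_consecutive (cl t) I; rewrite Ik.
have : (#|cl t @: I| <= q.+1 ^ M * b.+1 ^ (e * a))%N.
  apply: leq_trans (max_card _) _; rewrite card_prod !card_ffun !card_ord.
  by rewrite card_prod !card_ord.
have := card_long (cl t) I m; set L := [set _ | _ & _] => longL.
have longk : (4 * #|L| <= k)%N.
  rewrite -(leq_pmul2r m0) -mulnA [leqRHS]mulnC; apply: leq_trans mk.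
  by rewrite leq_mul2l.
pose N := [set uv | [exists i, bad Y W j t i uv.1 uv.2]].
have NB : (8 * #|N| <= k)%N.
  apply: leq_trans few_bad; rewrite leq_mul2l /= /bad_count (bigD1 t) //=.
  apply: leq_trans (leq_addr _ _).
  rewrite exchange_big /=; under eq_bigr do rewrite exchange_big /=.
  rewrite pair_big -sum1_card [leqLHS]big_mkcond /=; apply: leq_sum => -[u v] _ /=.
  rewrite inE /=; case: existsP => // -[i bi].
  by rewrite (bigD1 i) //= bi.
set C := [set _ | consecutive _ _ _ _].
set G := [set _ | good _ _ _].
have : (#|C| <= #|G| + #|L| + #|N|)%N.
  apply: leq_trans (_ : #|G :|: L :|: N| <= _)%N.
    apply/subset_leq_card/subsetP => -[u v]; rewrite !inE /= /good => c; rewrite c /=.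
    case: (leqP m) => [_|lt]; rewrite ?orbT //= orbF.
    case: (pickP (fun i => Y (u, (i, t i)) == Y (v, (i, t i)))) => [i eY|nY]; last first.
      by apply/orP; left; apply/forallP => i; rewrite nY.
    apply/orP; right.
    apply/existsP; exists i; rewrite /bad eY andbT /near lt andbT.
    by have /and5P[_ _ -> /eqP e' _] := c; rewrite /= -/(cl t) e'.
  apply: leq_trans (leq_card_setU _ _) _; rewrite leq_add2r.
  exact: leq_card_setU.
move: cells; lia.
Qed.

(** The good pairs of all scales form one graph, to which [proper_colouring_bound] applies. By
    [good_inj] the scales contribute disjoint edge sets, [k / 2] edges or more each, and a vertex
    has at most one neighbour per scale on either side. *)
Lemma edge_free_bound :
  \sum_x (edge_free Y W j x I)%:R <=
  expR (- ((k * a ^ e)%:R / (8 * q.+1%:R))) * #|{ffun 'I_n -> 'I_q.+1}|%:R :> K.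
Proof.
pose E u v := [exists t, good t u v].
(* A union over scales avoids choosing one; only one scale can contribute. *)
pose Bt u v := [set z | [exists t, good t u v && (z \in between (cl t) u v)]].
have BtE t u v : good t u v -> Bt u v = between (cl t) u v.
  move=> g; apply/setP => z; rewrite inE; apply/existsP/idP => [[t' /andP[g']]|bz].
    by rewrite (good_inj g g').
  by exists t; rewrite g.
have card_scale : #|{: scale}| = (a ^ e)%N by rewrite card_ffun !card_ord.
have EI u v : E u v -> [/\ u \in I, v \in I & (u < v)%N].
  by move=> /existsP[t /and3P[/and5P[]]].
have BtI u v : E u v -> [disjoint Bt u v & I].
  by move=> /existsP[t g]; rewrite (BtE t) //; have /and3P[/and5P[]] := g.
have Btm u v : E u v -> (#|Bt u v| <= m)%N.
  by move=> /existsP[t g]; rewrite (BtE t) //; have /and3P[_ /ltnW] := g.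
have degin v : (#|[set u | E u v]| <= a ^ e)%N.
  rewrite -card_scale -cardsT.
  pose f t := odflt v [pick u | good t u v].
  apply: leq_trans (leq_imset_card f _); apply/subset_leq_card/subsetP => u.
  rewrite inE => /existsP[t g]; apply/imsetP; exists t; rewrite // /f.
  case: pickP => [u' g'|/(_ u)]; last by rewrite g.
  by have [/and3P[c _ _] /and3P[c' _ _]] := (g, g'); exact: consecutive_injl c c'.
have degout u : (#|[set v | E u v]| <= a ^ e)%N.
  rewrite -card_scale -cardsT.
  pose f t := odflt u [pick v | good t u v].
  apply: leq_trans (leq_imset_card f _); apply/subset_leq_card/subsetP => v.
  rewrite inE => /existsP[t g]; apply/imsetP; exists t; rewrite // /f.
  case: pickP => [v' g'|/(_ v)]; last by rewrite g.
  by have [/and3P[c _ _] /and3P[c' _ _]] := (g, g'); exact: consecutive_injr c c'.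
have cardE : (a ^ e * k <= 2 * #|[set uv | E uv.1 uv.2]|)%N.
  apply: (@leq_trans (2 * \sum_t #|[set uv | good t uv.1 uv.2]|)%N).
    rewrite big_distrr /= -card_scale -cardsT -sum_nat_const [leqLHS]big_mkcond /=.
    apply: leq_sum => t _; rewrite inE.
    exact: card_good.
  rewrite leq_mul2l /=; under eq_bigr do rewrite -sum1_card big_mkcond.
  rewrite exchange_big -[leqRHS]sum1_card [leqRHS]big_mkcond /=.
  apply: leq_sum => -[u v] _; rewrite inE /= -big_mkcond /=.
  case: (boolP (E u v)) => [/existsP[t g]|/existsPn nE].
    rewrite (bigD1 t) ?inE //= big1 ?addn0 // => t' /andP[].
    by rewrite inE => g' /eqP[]; exact: good_inj g' g.
  by rewrite big1 // => t; rewrite inE /= (negbTE (nE t)).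
have q0 : (0 < #|'I_q.+1|)%N by rewrite card_ord.
have := @proper_colouring_bound K n 'I_q.+1 m (a ^ e)%N I E Bt.
rewrite card_ord => /(_ mq aq isT EI BtI Btm degin degout) H.
apply: le_trans (_ : _ <= expR (- (#|[set uv | E uv.1 uv.2]|%:R / (4 * q.+1%:R)))
   * #|{ffun 'I_n -> 'I_q.+1}|%:R) _; last first.
  rewrite ler_wpM2r // ler_expR lerN2 ler_pdivrMr ?mulr_gt0 ?ltr0n //.
  have cancel (c y : K) : 0 < y -> c / (4 * y) * (8 * y) = 2 * c.
    by move=> /lt0r_neq0 y0; field.
  rewrite cancel ?ltr0n //.
  by rewrite -natrM ler_nat mulnC.
apply: le_trans H; apply: ler_sum => x _; rewrite ler_nat.
case: (boolP (edge_free _ _ _ _ _)) => // ef; rewrite lt0b.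
apply/forallP => u; apply/forallP => v; apply: contra ef.
move=> /and3P[/existsP[t g] xuv /allowedP al].
have /and3P[/and5P[uI vI uv /eqP cuv _] _ _] := g.
apply/existsP; exists t; apply/exists_inP; exists u => //; apply/exists_inP; exists v => //.
rewrite /edge uv xuv -[cell _ _ _ _ u]/(cl t u) cuv eqxx /=.
by apply/forall_inP => z zB; apply: al; rewrite (BtE t).
Qed.

End Level.
End Levels.

(** * The first-moment argument over all digits *)

Section Existence.
Variables (K : realType) (n e a M q b m k : nat).
Let key : finType := ('I_n * ('I_e * 'I_a))%type.
Let dirs := {ffun key -> 'I_b.+1}.
Let cols := {ffun 'I_M -> {ffun 'I_n -> 'I_q.+1}}.
Implicit Types (Y : dirs) (W : cols) (j : 'I_M) (I : {set 'I_n}).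
Hypotheses (m0 : (0 < m)%N).
Hypothesis cells : (8 * (q.+1 ^ M * b.+1 ^ (e * a)) <= k)%N.
Hypothesis mk : (4 * n <= m * k)%N.
Hypotheses (mq : (4 * m <= q.+1)%N) (aq : (8 * a ^ e <= q.+1)%N).

Lemma k_gt0 : (0 < k)%N.
Proof. by apply: leq_trans cells; rewrite muln_gt0 muln_gt0 !expn_gt0. Qed.

(** A cell of level [j'] reads only levels below [j'], so the levels can be exposed in increasing
    order. *)
Lemma cell_recolour Y W j j' x t :
  (j' <= j)%N -> cell Y (upd W j x) j' t = cell Y W j' t.
Proof.
move=> j'j; apply/funext => u; congr pair; apply/ffunP => l; rewrite !ffunE.
case: ifP => // lj'; case: eqP lj' => // ->.
by rewrite ltnNge j'j.
Qed.

Lemma bad_count_recolour Y W j j' x :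
  (j' <= j)%N -> bad_count m Y (upd W j x) j' = bad_count m Y W j'.
Proof.
move=> j'j; do 4!apply: eq_bigr => ? _.
by rewrite /bad /near cell_recolour.
Qed.

Lemma edge_free_recolour Y W j j' x y I :
  (j' <= j)%N -> edge_free Y (upd W j x) j' y I = edge_free Y W j' y I.
Proof.
move=> j'j; congr (~~ _); apply: eq_existsb => t; apply: eq_existsb => u.
congr (_ && _); apply: eq_existsb => v; congr (_ && _).
by rewrite /edge cell_recolour.
Qed.

(** The bound on bad pairs is part of the event: where it fails the event is empty, so the estimate
    for one level holds for all [Y] and [W]. *)
Let unhit Y W I j := (8 * bad_count m Y W j <= k)%N && edge_free Y W j (W j) I.

Lemma all_levels_bound Y I : #|I| = k ->
  \sum_W [forall j, unhit Y W I j]%:R <=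
  expR (- ((k * a ^ e)%:R / (8 * q.+1%:R))) ^+ M * #|{: cols}|%:R :> K.
Proof.
move=> Ik; set r := expR _; have r0 : 0 <= r by apply: expR_ge0.
pose G l W := [forall j : 'I_M, (j < l)%N ==> unhit Y W I j].
have key_step l : (l <= M)%N -> \sum_W (G l W)%:R <= r ^+ l * #|{: cols}|%:R.
  elim: l => [_|l IH lM].
    by rewrite expr0 mul1r -sumr_const ler_sum // => W _; rewrite lern1 leq_b1.
  rewrite exprS -mulrA; apply: le_trans (ler_wpM2l r0 (IH (ltnW lM))).
  pose j := Ordinal lM.
  apply: (@resample_le _ _ _ j) => [|W].
    by rewrite card_ffun !card_ord expn_gt0.
  have GS x : (G l.+1 (upd W j x) <=
      G l W && ((8 * bad_count m Y W j <= k)%N && edge_free Y W j x I))%N.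
    case: (boolP (G l.+1 _)) => // /forall_inP H; rewrite lt0b; apply/andP; split.
      apply/forall_inP => i il; have := H i (leqW il).
      have ij : (i <= j)%N by exact: ltnW.
      have iNj : i != j by apply: contraTneq il => ->; rewrite ltnn.
      rewrite /unhit (bad_count_recolour _ _ _ ij).
      by rewrite (edge_free_recolour _ _ _ _ _ ij) upd_other.
    have := H j (ltnSn l); rewrite /unhit (bad_count_recolour _ _ _ (leqnn j)).
    by rewrite (edge_free_recolour _ _ _ _ _ (leqnn j)) upd_same.
  apply: (@le_trans _ _ (\sum_x
      (G l W && ((8 * bad_count m Y W j <= k)%N && edge_free Y W j x I))%:R)).
    by apply: ler_sum => x _; rewrite ler_nat; exact: GS.
  case: (G l W) => /=; last by rewrite big1 ?mulr0.
  have [few|_] := leqP (8 * bad_count m Y W j) k; last first.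
    by rewrite big1 // mulr1 mulr_ge0 ?ler0n.
  rewrite mulr1; exact: (edge_free_bound K m0 Ik cells mk mq aq few).
apply: le_trans (key_step M (leqnn M)); apply: ler_sum => W _; rewrite ler_nat.
case: forallP => // H; rewrite lt0b.
by apply/forall_inP => j _; exact: H.
Qed.

(** Otherwise every choice of digits has too many bad pairs or a [k]-set unhit at every level.
    Markov's inequality makes the first have probability below one half, and the union bound over
    the [k]-sets makes the second at most one half. *)
Theorem exists_hitting_digits :
  (16 * (M * a ^ e * e * n * m) < b.+1 * k)%N ->
  'C(n, k)%:R * expR (- ((k * a ^ e)%:R / (8 * q.+1%:R))) ^+ M < 2^-1 :> K ->
  exists Y W, forall I : {set 'I_n}, #|I| = k -> exists j, ~~ edge_free Y W j (W j) I.
Proof.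
move=> badk few; have k0 : 0 < k%:R :> K by rewrite ltr0n k_gt0.
have B0 : 0 < b.+1%:R :> K by rewrite ltr0n.
apply: contrapT => none.
have fail Y W : exists2 I : {set 'I_n}, #|I| = k & forall j, edge_free Y W j (W j) I.
  apply: contrapT => ok; apply: none; exists Y, W => I Ik.
  apply: contrapT => allf; apply: ok; exists I => // j.
  by apply: contrapT => /negP nf; apply: allf; exists j.
(* If the bad counts sum to more than [k / 8], the first term is at least 1; otherwise the set given
   by [fail] contributes 1 to the second. *)
have pt Y W : 1 <= (\sum_j bad_count m Y W j)%:R * 8 / k%:R +
    \sum_(I : {set 'I_n} | #|I| == k) [forall j, unhit Y W I j]%:R :> K.
  have s0 : 0 <= \sum_(I : {set 'I_n} | #|I| == k) [forall j, unhit Y W I j]%:R :> K.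
    by apply: sumr_ge0.
  have [le|lt] := leqP (8 * \sum_j bad_count m Y W j) k; last first.
    rewrite ler_wpDr // ler_pdivlMr // mul1r -natrM ler_nat mulnC; exact: ltnW.
  rewrite ler_wpDl ?divr_ge0 ?mulr_ge0 //.
  have [I Ik If] := fail Y W; rewrite (bigD1 I) ?Ik //= ler_wpDr ?sumr_ge0 //.
  rewrite ler1n lt0b; apply/forallP => j; rewrite /unhit If andbT.
  by apply: leq_trans le; rewrite leq_mul2l (bigD1 j) //= leq_addr.
have [cY cW] : 0 < #|{: dirs}|%:R :> K /\ 0 < #|{: cols}|%:R :> K.
  by rewrite !ltr0n !card_ffun !card_ord !expn_gt0.
have : #|{: dirs}|%:R * #|{: cols}|%:R <= \sum_(W : cols) \sum_(Y : dirs)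
    ((\sum_j bad_count m Y W j)%:R * 8 / k%:R +
    \sum_(I : {set 'I_n} | #|I| == k) [forall j, unhit Y W I j]%:R) :> K.
  rewrite mulr_natr -sumr_const; apply: ler_sum => W _.
  by rewrite -sumr_const; apply: ler_sum => Y _; exact: pt.
under eq_bigr do rewrite big_split /=.
rewrite big_split /= leNgt => /negP; apply.
set X := (M * a ^ e * e * n * m)%N in badk.
have part1 : \sum_(W : cols) \sum_(Y : dirs) (\sum_j bad_count m Y W j)%:R * 8 / k%:R
    < 2^-1 * (#|{: dirs}|%:R * #|{: cols}|%:R) :> K.
  apply: (@le_lt_trans _ _ (X%:R / b.+1%:R * 8 / k%:R * (#|{: dirs}|%:R * #|{: cols}|%:R))).
    rewrite mulrA [leRHS]mulr_natr -sumr_const; apply: ler_sum => W _.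
    rewrite -!mulr_suml -[leRHS]mulrA.
    rewrite [leRHS](_ : _ = X%:R / b.+1%:R * #|{: dirs}|%:R * 8 / k%:R); last by ring.
    rewrite ler_pM2r ?invr_gt0 // ler_pM2r //.
    exact: sum_bad_count.
  rewrite ltr_pM2r ?mulr_gt0 // ltr_pdivrMr // mulrAC ltr_pdivrMr //.
  have : (16 * X)%:R < (b.+1 * k)%:R :> K by rewrite ltr_nat.
  by rewrite !natrM; lra.
have part2 : \sum_(W : cols) \sum_(Y : dirs)
    \sum_(I : {set 'I_n} | #|I| == k) [forall j, unhit Y W I j]%:R
    <= 2^-1 * (#|{: dirs}|%:R * #|{: cols}|%:R) :> K.
  rewrite exchange_big /=.
  apply: (@le_trans _ _ (\sum_(Y : dirs) \sum_(I : {set 'I_n} | #|I| == k)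
      (expR (- ((k * a ^ e)%:R / (8 * q.+1%:R))) ^+ M * #|{: cols}|%:R))).
    apply: ler_sum => Y _; rewrite exchange_big; apply: ler_sum => I /eqP Ik.
    exact: all_levels_bound.
  have cI : #|[pred I : {set 'I_n} | #|I| == k]| = 'C(n, k).
    by rewrite -[in RHS](card_ord n) -card_draws cardsE.
  move: few; set E := expR _ ^+ M => few.
  rewrite !sumr_const cI -mulrnA -[leLHS]mulr_natl [X in X * _]natrM.
  by rewrite mulrACA ler_pM2r ?mulr_gt0 // ltW.
apply: lt_le_trans (ltr_leD part1 part2) _; rewrite -mulrDl -[leRHS]mul1r.
by rewrite ler_pM2r ?mulr_gt0 // [leRHS]splitr mul1r.
Qed.

End Existence.

(** * From digits to points and boxes *)

Section DigitExpansion.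
Variable B : nat.
Implicit Types f g : nat -> nat.

(* The first [l] digits are the most significant ones, so that sharing a prefix
   of digits means lying in a common interval. *)
Fixpoint expansion f (l : nat) : nat :=
  (if l is l'.+1 then expansion f l' * B + f l' else 0)%N.

Lemma expansion_div f t r : (forall i, f i < B)%N ->
  (expansion f (t + r) %/ B ^ r = expansion f t)%N.
Proof.
move=> fB; have B0 : (0 < B)%N by apply: leq_trans (fB 0%N).
elim: r => [|r IH]; first by rewrite addn0 divn1.
by rewrite addnS /= expnS divnMA divnMDl // (divn_small (fB _)) addn0.
Qed.

Lemma expansion_inj f g t : (forall i, f i < B)%N -> (forall i, g i < B)%N ->
  expansion f t = expansion g t -> forall i, (i < t)%N -> f i = g i.
Proof.
move=> fB gB; have B0 : (0 < B)%N by apply: leq_trans (fB 0%N).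
elim: t => // t IH /= e i.
have et : f t = g t by have := congr1 (modn^~ B) e; rewrite /= !modnMDl !modn_small.
rewrite ltnS leq_eqVlt => /predU1P[->//|]; apply: IH.
by have := congr1 (divn^~ B) e; rewrite /= !divnMDl // (divn_small (fB _)) (divn_small (gB _)) !addn0.
Qed.

Lemma eq_expansion f g t : (forall i, (i < t)%N -> f i = g i) ->
  expansion f t = expansion g t.
Proof.
elim: t => //= t IH fg; rewrite IH => [|i it]; first by rewrite fg.
by apply: fg; apply: leqW.
Qed.

(** Integer division by [B ^ (l - t)] erases all but the first [t] digits. This makes a condition on
    a prefix one side of a box. *)
Lemma expansion_itv f g t l : (forall i, f i < B)%N -> (forall i, g i < B)%N ->
  (t <= l)%N ->
  reflect (forall i, (i < t)%N -> f i = g i)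
    (expansion f t * B ^ (l - t) <= expansion g l < (expansion f t).+1 * B ^ (l - t))%N.
Proof.
move=> fB gB tl; have B0 : (0 < B)%N by apply: leq_trans (fB 0%N).
have Bl : (0 < B ^ (l - t))%N by rewrite expn_gt0 B0.
rewrite -leq_divRL // -ltn_divLR // ltnS -eqn_leq.
rewrite -{1}(subnKC tl) expansion_div //.
apply: (iffP eqP) => [e i it|]; first exact: expansion_inj e i it.
exact: eq_expansion.
Qed.

End DigitExpansion.

(** * The point set with given digits and its isolating boxes *)

Section Points.
Variables (K : realType) (n e a M q b : nat).
Let key : finType := ('I_n * ('I_e.+1 * 'I_a))%type.
Variables (Y : {ffun key -> 'I_b.+1}) (W : {ffun 'I_M -> {ffun 'I_n -> 'I_q.+1}}).
Implicit Types (u v z : 'I_n) (c : 'I_e.+3).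

(** Digits out of range are 0, since [expansion] takes digit sequences indexed by all natural
    numbers. *)
Definition colour_digit u (l : nat) : nat :=
  oapp (fun l : 'I_M => W l u : nat) 0%N (insub l).
Definition dir_digit u (i : 'I_e.+1) (l : nat) : nat :=
  oapp (fun l : 'I_a => Y (u, (i, l)) : nat) 0%N (insub l).

Lemma colour_digit_lt u l : (colour_digit u l < q.+1)%N.
Proof. by rewrite /colour_digit; case: insub => //= l'; exact: ltn_ord. Qed.

Lemma dir_digit_lt u i l : (dir_digit u i l < b.+1)%N.
Proof. by rewrite /dir_digit; case: insub => //= l'; exact: ltn_ord. Qed.

Lemma colour_digitE u (l : 'I_M) : colour_digit u l = W l u.
Proof. by rewrite /colour_digit valK. Qed.

Lemma dir_digitE u i (l : 'I_a) : dir_digit u i l = Y (u, (i, l)).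
Proof. by rewrite /dir_digit valK. Qed.

Definition coord u (c : nat) : nat :=
  match c with
  | 0 => u
  | 1 => expansion q.+1 (colour_digit u) M
  | c'.+2 => expansion b.+1 (dir_digit u (inord c')) a
  end.

Definition point u : 'rV[K]_e.+3 := \row_(c < e.+3) (coord u c)%:R.

Lemma point_inj : injective point.
Proof.
move=> u v /rowP/(_ ord0); rewrite !mxE /= => /eqP.
by rewrite eqr_nat => /eqP/val_inj.
Qed.

Section Box.
Variables (j : 'I_M) (t : {ffun 'I_e.+1 -> 'I_a}) (u v : 'I_n).

(** The colour prefix has length [j.+1], one more than in [cell], so that it also fixes the shared
    digit of level [j]; the direction prefixes are exactly those of the cell. *)
Definition lower (c : nat) : nat :=
  (match c with
  | 0 => u
  | 1 => expansion q.+1 (colour_digit u) j.+1 * q.+1 ^ (M - j.+1)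
  | c'.+2 => expansion b.+1 (dir_digit u (inord c')) (t (inord c'))
               * b.+1 ^ (a - t (inord c'))
  end)%N.

Definition upper (c : nat) : nat :=
  (match c with
  | 0 => v.+1
  | 1 => (expansion q.+1 (colour_digit u) j.+1).+1 * q.+1 ^ (M - j.+1)
  | c'.+2 => (expansion b.+1 (dir_digit u (inord c')) (t (inord c'))).+1
               * b.+1 ^ (a - t (inord c'))
  end)%N.

Definition box : classical_sets.set 'rV[K]_e.+3 :=
  fun x => forall c, (lower c)%:R <= x ord0 c < (upper c)%:R.

Lemma box_point z : box (point z) <->
  [/\ (u <= z <= v)%N, cell Y W j t z = cell Y W j t u & W j z = W j u].
Proof.
have -> : box (point z) <-> forall c : 'I_e.+3, (lower c <= coord z c < upper c)%N.
  by split=> H c; have := H c; rewrite mxE ler_nat ltr_nat.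
have colP := expansion_itv (colour_digit_lt u) (colour_digit_lt z) (ltn_ord j).
have dirP i := expansion_itv (dir_digit_lt u i) (dir_digit_lt z i) (ltnW (ltn_ord (t i))).
split=> [H|[uzv /eqP/cellP[eW eY] ej] [[|[|c]] clt]].
- have /colP eW := H (@Ordinal e.+3 1 isT).
  split.
  + exact: (H ord0).
  + apply/eqP/cellP; split=> [l lj|i l lt].
      by apply/val_inj; rewrite /= -!colour_digitE eW // ltnS ltnW.
    have clt : (i.+2 < e.+3)%N by rewrite !ltnS -ltnS.
    have := H (Ordinal clt); rewrite /lower /upper /coord /= inord_val => /dirP eY.
    by apply/val_inj; rewrite /= -!dir_digitE eY.
  + by apply/val_inj; rewrite /= -!colour_digitE eW.
- exact: uzv.
- apply/colP => l; rewrite ltnS leq_eqVlt => /predU1P[->|lj].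
    by rewrite !colour_digitE ej.
  have lM : (l < M)%N by apply: ltn_trans lj _.
  by have := colour_digitE _ (Ordinal lM) => /= E; rewrite !E eW.
apply/dirP => l lt; have la : (l < a)%N by apply: ltn_trans lt _.
by have := dir_digitE _ _ (Ordinal la) => /= E; rewrite !E eY.
Qed.

Lemma box_axis_parallel : axis_parallel_box box.
Proof.
exists (fun c => [set x | (lower c)%:R <= x < (upper c)%:R]%classic) => // c; split.
  move=> x y /= /andP[lx _] /andP[_ yu] z /andP[xz zy].
  by rewrite (le_trans lx xz) (le_lt_trans zy yu).
exists (upper c)%:R; split; first by rewrite num_real.
move=> y /ltW yU x /= /andP[lx xu].
rewrite ger0_norm; first by apply: le_trans yU; exact: ltW.
by apply: le_trans lx; rewrite ler0n.
Qed.

End Box.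

Definition points : {fset 'rV[K]_e.+3} := [fset point u | u in 'I_n]%fset.

Lemma card_points : #|` points|%fset = n.
Proof. by rewrite card_imfset; [rewrite size_enum_ord|exact: point_inj]. Qed.

Lemma point_in u : point u \in points.
Proof. exact: in_imfset. Qed.

Lemma edge_delaunay j t u v : edge Y W j t (W j) u v ->
  delaunay_graph [` point_in u]%fset [` point_in v]%fset.
Proof.
move=> /and4P[uv /eqP cuv /eqP wuv /forall_inP empty]; apply/asboolP; split.
  by move=> /(congr1 val) /point_inj uv'; rewrite uv' ltnn in uv.
exists (box j t u v); first exact: box_axis_parallel.
apply/seteqP; split=> [x [bx /imfsetP[z _ xz]]|x [->|->]] /=; last 2 first.
- by split; [apply/box_point; rewrite leqnn ltnW|exact: point_in].
- by split; [apply/box_point; rewrite leqnn ltnW|exact: point_in].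
move: bx; rewrite xz => /box_point[/andP[uz zv] cz wz].
move: uz; rewrite leq_eqVlt => /orP[/eqP/val_inj->|uz]; first by left.
move: zv; rewrite leq_eqVlt => /orP[/eqP/val_inj->|zv]; first by right.
by have := empty z; rewrite inE uz zv cz wz !eqxx => /(_ isT).
Qed.

Theorem independence_points k : (0 < k)%N ->
  (forall I : {set 'I_n}, #|I| = k -> exists j, ~~ edge_free Y W j (W j) I) ->
  (independence_number (@delaunay_graph K e.+3 points) < k)%N.
Proof.
move=> k0 hit; rewrite -(prednK k0) ltnS; apply/bigmax_leqP => S indS.
rewrite -ltnS (prednK k0) ltnNge; apply/negP => kS.
pose p u : points := [` point_in u]%fset.
pose I0 := [set u | p u \in S].
have kI0 : (k <= #|I0|)%N.
  apply: leq_trans kS _; apply: leq_trans (leq_imset_card p _).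
  apply/subset_leq_card/subsetP => x xS.
  have /imfsetP[u _ xu] := valP x.
  have xp : x = p u by apply: val_inj.
  by apply/imsetP; exists u; rewrite // inE -xp.
(* The hypothesis concerns sets of exactly [k] indices, so the larger set is truncated. *)
pose I := [set u in take k (enum I0)].
have II0 u : u \in I -> p u \in S.
  by rewrite inE => /mem_take; rewrite mem_enum inE.
have Ik : #|I| = k.
  rewrite cardsE; have /card_uniqP -> := take_uniq k (enum_uniq I0).
  by rewrite size_takel // -cardE.
have [j] := hit I Ik; rewrite negbK.
move=> /existsP[t /exists_inP[u uI /exists_inP[v vI /edge_delaunay uv]]].
have /forall_inP/(_ _ (II0 u uI))/forall_inP/(_ _ (II0 v vI)) := indS.
by rewrite uv.
Qed.

End Points.

(** * Choice of the parameters *)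

(** By induction on [p]: half of the exponent absorbs the extra factor [r], and the other half is
    left to the induction hypothesis with [c] doubled. *)
Lemma poly_le_pow2 (p C c : nat) : (0 < c)%N ->
  exists r0, forall r, (r0 <= r)%N -> (C * r ^ p <= 2 ^ (r %/ c))%N.
Proof.
elim: p C c => [|p IH] C c c0.
  exists (c * C)%N => r cr; rewrite expn0 muln1.
  apply: leq_trans (ltnW (ltn_expl C (ltnSn 1))) _.
  by rewrite leq_exp2l // leq_divRL // mulnC.
have c20 : (0 < 2 * c)%N by rewrite muln_gt0.
have [r0 H] := IH (C * (2 * c))%N (2 * c)%N c20.
exists r0 => r /H {}H; set g := (r %/ (2 * c))%N in H.
have gr : (2 * g <= r %/ c)%N.
  by rewrite leq_divRL // mulnAC mulnC; apply: leq_trunc_div.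
have rg : (r <= 2 * c * 2 ^ g)%N.
  apply: leq_trans (ltnW (ltn_ceil r c20)) _.
  by rewrite mulnC leq_mul2l ltn_expl // orbT.
apply: (@leq_trans (2 ^ (2 * g))); last by rewrite leq_exp2l.
rewrite expnS mulnA (mulnC C) -mulnA mul2n -addnn expnD.
apply: (@leq_trans (2 * c * 2 ^ g * (C * r ^ p))); first by rewrite leq_mul2r rg orbT.
by rewrite mulnAC leq_mul2r (mulnC (2 * c)%N) -mulnA (mulnC (r ^ p)%N) mulnA H orbT.
Qed.

Lemma bin_le (K : realFieldType) n k (x : K) : 0 <= x ->
  'C(n, k)%:R * x ^+ k <= (1 + x) ^+ n.
Proof.
move=> x0; have [kn|nk] := leqP k n; last by rewrite bin_small // mul0r exprn_ge0 ?addr_ge0.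
rewrite exprDn (bigD1 (Ordinal (kn : k < n.+1)%N)) //= expr1n mul1r mulr_natl.
by rewrite lerDl sumr_ge0 // => i _; rewrite mulrn_wge0 // mulr_ge0 ?exprn_ge0.
Qed.

(** Take [x = 1 / s] in [bin_le] and use [(1 + 1 / s) ^ n <= expR (n / s) <= expR k]. *)
Lemma bin_expR_le (K : realType) n k s : (0 < s)%N -> (n <= s * k)%N ->
  'C(n, k)%:R <= (expR 1 * s%:R) ^+ k :> K.
Proof.
move=> s0 nsk; have s0' : 0 < s%:R :> K by rewrite ltr0n.
have := @bin_le K n k s%:R^-1; rewrite invr_ge0 ler0n => /(_ isT).
rewrite exprVn ler_pdivrMr ?exprn_gt0 // => /le_trans; apply.
rewrite exprMn ler_wpM2r ?exprn_ge0 // -expRM_natr mul1r.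
apply: le_trans (_ : expR s%:R^-1 ^+ n <= _).
  by apply: lerXn2r (expR_ge1Dx _); rewrite nnegrE ?addr_ge0 ?expR_ge0 ?invr_ge0.
rewrite -expRM_natr ler_expR mulrC ler_pdivrMr // mulrC -natrM ler_nat.
exact: nsk.
Qed.

Lemma expR1_ge2 (K : realType) : 2 <= expR 1 :> K.
Proof. exact: expR_ge1Dx. Qed.

(** With [y = expR 1 >= 2], the hypothesis gives [s <= y ^ (h - 3)], so the product is at most
    [(y * s / y ^ h) ^ k <= (1 / 4) ^ k]. *)
Lemma union_bound (K : realType) n k s h : (0 < k)%N -> (0 < s)%N ->
  (n <= s * k)%N -> (8 * s <= 2 ^ h)%N ->
  'C(n, k)%:R * expR (- (k * h)%:R) < 2^-1 :> K.
Proof.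
move=> k0 s0 nsk sh; have e2 := @expR1_ge2 K; have e0 : 0 < expR 1 :> K by apply: expR_gt0.
set y := expR 1 in e2 e0.
have yN l : expR (- l%:R) = y ^- l by rewrite expRN -[l%:R]mul1r expRM_natr.
have h3 : (2 < h)%N.
  by rewrite -(@ltn_exp2l 2) //; apply: leq_trans sh; lia.
have [h' hE] : exists h', h = h'.+3 by exists (h - 3)%N; lia.
have s_le : s%:R <= y ^+ h' :> K.
  apply: (@le_trans _ _ (2 ^+ h')); last first.
    by apply: lerXn2r => //; rewrite nnegrE ?ler0n // (ltW e0).
  rewrite -natrX ler_nat -(@leq_pmul2l 8) //; apply: leq_trans sh _.
  by rewrite hE !expnS; lia.
apply: (@le_lt_trans _ _ ((y * s%:R) ^+ k * y ^- (k * h))).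
  rewrite yN; apply: ler_wpM2r; last exact: bin_expR_le.
  by rewrite invr_ge0 exprn_ge0 // ltW.
rewrite mulnC exprM -exprVn -exprMn.
have z_le : y * s%:R / y ^+ h <= 4^-1.
  rewrite ler_pdivrMr ?exprn_gt0 // hE !exprS.
  have y0 : 0 <= y ^+ h' by rewrite exprn_ge0 // ltW.
  move: s_le y0; set Z := y ^+ h'; set S := s%:R => s_le y0.
  have : y * S <= y * Z by rewrite ler_wpM2l // ltW.
  have : 4 * (y * Z) <= y * (y * (y * Z)).
    rewrite [y * (y * _)]mulrA; apply: ler_wpM2r; last by nra.
    by rewrite mulr_ge0 // ltW.
  lra.
apply: (@le_lt_trans _ _ (4^-1 ^+ k)).
  by apply: lerXn2r z_le; rewrite nnegrE ?invr_ge0 // divr_ge0 ?mulr_ge0 ?exprn_ge0 // ltW.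
apply: (@le_lt_trans _ _ 4^-1); last by lra.
by rewrite -[leRHS]expr1; apply: ler_wiXn2l => //; lra.
Qed.

Theorem sparse_delaunay (K : realType) (e : nat) :
  exists r0, forall r n, (r0 <= r)%N -> (2 ^ r ^ 4 <= n)%N ->
    exists2 P : {fset 'rV[K]_e.+3}, #|` P|%fset = n &
      (independence_number (@delaunay_graph K e.+3 P) * r ^ (2 * e.+2) <= n)%N.
Proof.
have [r1 H1] := @poly_le_pow2 (2 * e.+2) 16 128 isT.
(* [B = C2 * r ^ p2] is chosen so that [B * k] equals [64 * e.+1 * M * a ^ e.+1 * s * (s * k)]; as
   [n < s * k], this beats the Markov requirement. *)
pose C2 := (64 * e.+1)%N; pose p2 := (2 * e.+1 + 3 + 2 * e.+2 + 2 * e.+2)%N.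
have [r2 H2] := @poly_le_pow2 (p2 * e.+1) (C2 ^ e.+1) 128 isT.
exists (maxn r1 r2).+1 => r n; rewrite gtn_max => /andP[/ltnW/H1 {}H1 rr2] rn.
have {}H2 := H2 r (ltnW rr2).
have r0 : (0 < r)%N by apply: leq_ltn_trans rr2.
have rp0 p : (0 < r ^ p)%N by rewrite expn_gt0 r0.
set s := (r ^ (2 * e.+2))%N in H1 *; have s0 : (0 < s)%N by exact: rp0.
set h := (r %/ 128)%N in H1 H2.
(* [m = 4 * s] gives [4 * n <= m * k], and [q.+1 = 16 * s] is then [4 * m]. The divisor 128 in [h]
   is [8 * 16], from the exponent of the hitting bound. *)
pose a := (r ^ 2)%N; pose M := (r ^ 3)%N; pose m := (4 * s)%N; pose q := (16 * s).-1.
pose B := (C2 * r ^ p2)%N; pose b := B.-1; pose k := (n %/ s).+1.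
have qE : q.+1 = (16 * s)%N by rewrite prednK // muln_gt0.
have bE : b.+1 = B by rewrite prednK // !muln_gt0 rp0.
have k0 : (0 < k)%N by [].
have nsk : (n < s * k)%N by rewrite mulnC; exact: ltn_ceil.
have cells : (8 * (q.+1 ^ M * b.+1 ^ (e.+1 * a)) <= k)%N.
  (* Both [16 * s] and [B ^ e.+1] are at most [2 ^ h], so [s] times the left side is at most
     [2 ^ (h * (1 + M + a))], hence at most [2 ^ (r ^ 4)]. *)
  rewrite qE bE ltnW // -(ltn_pmul2l s0); apply: leq_ltn_trans nsk.
  apply: leq_trans rn.
  rewrite mulnA expnM; apply: (@leq_trans (2 ^ h * ((2 ^ h) ^ M * (2 ^ h) ^ a))).
    apply: leq_mul; first by apply: leq_trans H1; rewrite mulnC leq_mul2r orbT.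
    apply: leq_mul; rewrite leq_exp2r ?rp0 //.
    by rewrite expnMn -expnM.
  rewrite -!expnM -!expnD leq_exp2l //.
  have a_le : (a <= r ^ 3)%N by rewrite leq_pexp2l.
  apply: (@leq_trans (h * (3 * r ^ 3))).
    have := leq_mul (leqnn h) a_le; have := leq_mul (leqnn h) (rp0 3); rewrite /M; lia.
  rewrite mulnA [(r ^ 4)%N]expnS leq_mul2r; apply/orP; right; rewrite /h; lia.
have [|||||||Y [W hit]] := @exists_hitting_digits K n e.+1 a M q b m k.
- by rewrite muln_gt0.
- exact: cells.
- by rewrite /m -mulnA leq_mul2l /= ltnW.
- by rewrite qE /m mulnA.
- rewrite qE /a -expnM; apply: leq_mul => //.
  by rewrite leq_pexp2l //; lia.
- rewrite bE.
  have -> : (16 * (M * a ^ e.+1 * e.+1 * n * m) =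
      64 * e.+1 * (M * a ^ e.+1) * s * n)%N by rewrite /m; ring.
  have -> : (B * k = 64 * e.+1 * (M * a ^ e.+1) * s * (s * k))%N.
    rewrite /B /C2 /p2 /M /a /s -expnM !expnD.
    by move: (r ^ (2 * e.+1))%N (r ^ 3)%N (r ^ (2 * e.+2))%N => x y z; ring.
  have pos : (0 < 64 * e.+1 * (M * a ^ e.+1) * s)%N.
    have [Mp ap] : (0 < M)%N /\ (0 < a ^ e.+1)%N by rewrite expn_gt0 !rp0.
    by rewrite (muln_gt0 _ s) s0 andbT (muln_gt0 (64 * e.+1)) (muln_gt0 M) Mp ap.
  by rewrite (ltn_pmul2l pos).
- have -> : expR (- ((k * a ^ e.+1)%:R / (8 * q.+1%:R))) ^+ M =
      expR (- ((k * r)%:R / 128)) :> K.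
    rewrite -expRM_natr; congr expR; rewrite qE mulNr; congr (- _).
    have -> : (k * a ^ e.+1)%:R / (8 * (16 * s)%:R) * M%:R =
        (k * (a ^ e.+1 * M))%:R / (128 * s%:R) :> K.
      have cancel (x y z w : K) : w != 0 ->
          x * y / (8 * (16 * w)) * z = x * (y * z) / (128 * w) by move=> w0; field.
      by rewrite !(natrM _ k) !(natrM _ _ s) (natrM _ (a ^ e.+1)) cancel ?pnatr_eq0 -?lt0n.
    (* This leaves the exponent [k * r / 128], which is at least [k * h]. *)
    have -> : (a ^ e.+1 * M = r * s)%N.
      by rewrite /a /M /s -expnM -expnD -expnS; congr expn; lia.
    have cancel (x y w : K) : w != 0 -> x * (y * w) / (128 * w) = x * y / 128.
      by move=> w0; field.
    by rewrite (natrM _ k (r * s)) (natrM _ r) cancel ?(natrM _ k) // pnatr_eq0 -lt0n.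
  apply: le_lt_trans (@union_bound K n k s h k0 s0 (ltnW nsk) _).
    rewrite ler_wpM2l // ler_expR lerN2 ler_pdivlMr // -natrM ler_nat -mulnA leq_mul2l.
    by rewrite leq_trunc_div orbT.
  by apply: leq_trans H1; rewrite leq_mul2r orbT.
exists (points K Y W); first exact: card_points.
have := independence_points K k0 hit; rewrite ltnS => ind.
by apply: leq_trans (leq_trunc_div n s); rewrite leq_mul2r ind orbT.
Qed.

Theorem theorem1p4 (R : realType) (d : nat) (hd : (3 <= d)%N) :
  exists2 c : R, 0 < c &
    exists N : nat, forall n : nat, (N <= n)%N ->
      exists2 P : {fset 'rV[R]_d}, #|` P|%fset = n &
        (independence_number (@delaunay_graph R d P))%:R
          <= c * n%:R * ln (ln n%:R) `^ ((d%:R + 3) / 2)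
             / ln n%:R `^ ((d%:R - 1) / 2).
Proof.
case: d hd => [|[|[|e]]] // _.
have [r0 sparse] := sparse_delaunay R e.
exists (4 ^+ e.+2); first by rewrite exprn_gt0.
have [N1 N1e] : exists N1 : nat, expR (expR 1) <= N1%:R :> R.
  by exists (Num.truncn (expR (expR 1) : R)).+1; rewrite ltW // truncnS_gt.
(* [N1] ensures [ln (ln n) >= 1], and [r >= 1] gives [r.+1 <= 2 * r]. With [r] maximal,
   [ln n <= (2 * r) ^ 4], so the denominator is at most [4 ^ e.+2 * r ^ (2 * e.+2)], whence the
   constant. *)
exists (maxn N1 (2 ^ (maxn r0 1) ^ 4)) => n; rewrite geq_max => /andP[N1n rn].
have [r rP] : exists r, [/\ (maxn r0 1 <= r)%N, (2 ^ r ^ 4 <= n)%N & (n < 2 ^ r.+1 ^ 4)%N].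
  have ex : exists r, (2 ^ r ^ 4 <= n)%N by exists (maxn r0 1).
  have bd r : (2 ^ r ^ 4 <= n)%N -> (r <= n)%N.
    apply: leq_trans; apply: leq_trans (ltnW (ltn_expl _ (ltnSn 1))).
    by case: r => // r; rewrite -[leqLHS]expn1 leq_pexp2l.
  case: (ex_maxnP ex bd) => r rn' rmax; exists r; split=> //; first exact: rmax.
  by rewrite ltnNge; apply/negP => /rmax; rewrite ltnn.
move: rP => [+ rn' nr]; rewrite geq_max => /andP[r0r r1].
have [P cP indP] := sparse r n r0r rn'; exists P => //.
set ind := independence_number _ in indP *.
have n_ge : expR (expR 1) <= n%:R :> R by apply: le_trans N1e _; rewrite ler_nat.
have n0 : 0 < n%:R :> R by apply: lt_le_trans n_ge; exact: expR_gt0.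
have L_ge : expR 1 <= ln n%:R :> R.
  by rewrite -[leLHS]expRK ler_ln ?posrE ?expR_gt0.
have L0 : 0 < ln n%:R :> R by apply: lt_le_trans L_ge; exact: expR_gt0.
have LL_ge : 1 <= ln (ln n%:R) :> R.
  by rewrite -[leLHS]expRK ler_ln ?posrE ?expR_gt0.
have L_le : ln n%:R <= (4 * r%:R ^+ 2) ^+ 2 :> R.
  apply: (@le_trans _ _ (ln (2 ^+ (r.+1 ^ 4)))).
    by rewrite ler_ln ?posrE ?exprn_gt0 // -natrX ler_nat ltnW.
  rewrite lnXn // -[leLHS]mulr_natl; apply: (@le_trans _ _ ((r.+1 ^ 4)%:R * 1)).
    by rewrite ler_wpM2l // (le_ln1Dx (x := 1)) // (lt_trans (y := 0)) // ltrN10.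
  rewrite mulr1; have -> : (4 * r%:R ^+ 2) ^+ 2 = ((2 * r) ^ 4)%:R :> R.
    by rewrite natrX natrM; ring.
  by rewrite ler_nat leq_exp2r //; lia.
have powL : ln n%:R `^ ((e.+3%:R - 1) / 2) <= (4 * r%:R ^+ 2) ^+ e.+2 :> R.
  have -> : (e.+3%:R - 1) / 2 = e.+2%:R / 2 :> R by rewrite -[in e.+3%:R]addn1 natrD addrK.
  have x0 : 0 <= 4 * r%:R ^+ 2 :> R by rewrite mulr_ge0 // exprn_ge0.
  apply: (@le_trans _ _ (((4 * r%:R ^+ 2) ^+ 2) `^ (e.+2%:R / 2))).
    by apply: ge0_ler_powR => //; rewrite ?nnegrE ?exprn_ge0 ?divr_ge0 // ltW.
  have half2 : 2 * (e.+2%:R / 2) = e.+2%:R :> R by rewrite mulrC divfK // pnatr_eq0.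
  by rewrite -(powR_mulrn 2 x0) -powRrM half2 powR_mulrn.
have powLL : 1 <= ln (ln n%:R) `^ ((e.+3%:R + 3) / 2) :> R.
  apply: (@le_trans _ _ (1 `^ ((e.+3%:R + 3) / 2))); first by rewrite powR1.
  have x0 : 0 <= (e.+3%:R + 3) / 2 :> R by rewrite divr_ge0 // addr_ge0.
  apply: (ge0_ler_powR x0) => //; rewrite nnegrE //.
  exact: le_trans ler01 LL_ge.
rewrite ler_pdivlMr ?powR_gt0 //.
apply: (@le_trans _ _ (4 ^+ e.+2 * n%:R)); last first.
  by rewrite ler_peMr // mulr_ge0 ?exprn_ge0.
apply: le_trans (ler_wpM2l (ler0n _ ind) powL) _.
rewrite exprMn mulrCA ler_wpM2l ?exprn_ge0 // -exprM -natrX -natrM ler_nat.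
exact: indP.
Qed.
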